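(* Let $\mu\in\mathbb{H}$ satisfy $\mu^2=-1$, let $\mathcal{F}^{\mu}$ be the left quaternion Fourier transform with the single root $\mu$, and let $f,g:\mathbb{R}^2\to\mathbb{H}$ be integrable quaternion functions. Then the classical convolution of $f$ and $g$ is expressed in terms of Mustard convolutions by $$f*g=\frac12\Big[\,f*_\mu g-(\mu f)*_\mu(\mu g)+f*_\mu g^{(1,1)}+(\mu f)*_\mu(\mu g^{(1,1)})\Big].$$
   Context: $\mathbb{H}$ is the algebra of real quaternions. Quaternion functions are functions $f=f_0+f_1\boldsymbol{i}+f_2\boldsymbol{j}+f_3\boldsymbol{k}:\mathbb{R}^2\to\mathbb{H}$ with $f_0,f_1,f_2,f_3\in L^1(\mathbb{R}^2)$ real-valued; equalities between such functions are almost everywhere. For $q\in\mathbb{H}$, $qf$ is the pointwise left multiple. Reflections: for $\phi=(\phi_1,\phi_2)\in\{0,1\}^2$, $f^{\phi}(x)=f((-1)^{\phi_1}x_1,(-1)^{\phi_2}x_2)$. Exponential: for $\mu^2=-1$ and $\theta\in\mathbb{R}$, $e^{\mu\theta}=\cos\theta+\mu\sin\theta$. Left quaternion Fourier transform with one root $\mu$: $\mathcal{F}^{\mu}(f)(y)=\frac{1}{2\pi}\int_{\mathbb{R}^2}e^{-\mu(x_1y_1+x_2y_2)}f(x)\,dx$. Its inverse is formally $(\mathcal{F}^{\mu})^{-1}(h)(y)=\frac1{2\pi}\int_{\mathbb{R}^2}e^{\mu(x_1y_1+x_2y_2)}h(x)\,dx$. Classical convolution: $(f*g)(x)=\int_{\mathbb{R}^2}f(y)g(x-y)\,dy$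 (quaternion product in the integrand). Mustard convolution: $f*_\mu g:=2\pi(\mathcal{F}^{\mu})^{-1}\big(\mathcal{F}^{\mu}(f)\,\mathcal{F}^{\mu}(g)\big)$, with the pointwise quaternion product. For integrable $f,g$ this is understood as the unique integrable quaternion function $h$ with $\mathcal{F}^{\mu}(h)=2\pi\,\mathcal{F}^{\mu}(f)\mathcal{F}^{\mu}(g)$ (such an $h$ always exists). *)

(* Defs.v *)
From HB Require Import structures.
From mathcomp Require Import all_boot all_order all_algebra ring.
From mathcomp Require Import all_classical all_reals all_analysis.
Set Implicit Arguments.
Unset Strict Implicit.
Unset Printing Implicit Defensive.
Import Order.TTheory GRing.Theory Num.Theory.
Local Open Scope ring_scope.

(* The quaternion q0 + q1 i + q2 j + q3 k. *)
Record quaternion (R : Type) := Quaternion { q0 : R; q1 : R; q2 : R; q3 : R }.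

Definition quaternion_to_prod (R : Type) (q : quaternion R) :=
  (q0 q, q1 q, q2 q, q3 q).
Definition prod_to_quaternion (R : Type) (p : R * R * R * R) : quaternion R :=
  Quaternion p.1.1.1 p.1.1.2 p.1.2 p.2.
Lemma quaternion_to_prodK (R : Type) :
  cancel (@quaternion_to_prod R) (@prod_to_quaternion R).
Proof. by case. Qed.

HB.instance Definition _ (R : eqType) :=
  Equality.copy (quaternion R) (can_type (@quaternion_to_prodK R)).
HB.instance Definition _ (R : choiceType) :=
  Choice.copy (quaternion R) (can_type (@quaternion_to_prodK R)).

Section Algebra.
Variable R : comNzRingType.
Implicit Types p q r : quaternion R.

Definition addq p q :=
  Quaternion (q0 p + q0 q) (q1 p + q1 q) (q2 p + q2 q) (q3 p + q3 q).
Definition oppq q := Quaternion (- q0 q) (- q1 q) (- q2 q) (- q3 q).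
Definition zeroq : quaternion R := Quaternion 0 0 0 0.

Fact addqA : associative addq.
Proof. by case=> ? ? ? ? [? ? ? ?] [? ? ? ?]; rewrite /addq /= !addrA. Qed.
Fact addqC : commutative addq.
Proof. by case=> a b c d [e f g h]; congr Quaternion; rewrite addrC. Qed.
Fact add0q : left_id zeroq addq.
Proof. by case=> ? ? ? ?; rewrite /addq /= !add0r. Qed.
Fact addNq : left_inverse zeroq oppq addq.
Proof. by case=> ? ? ? ?; rewrite /addq /= !addNr. Qed.

HB.instance Definition _ :=
  GRing.isZmodule.Build (quaternion R) addqA addqC add0q addNq.

(* Hamilton's product, determined by i^2 = j^2 = k^2 = ijk = -1. *)
Definition mulq p q := Quaternion
  (q0 p * q0 q - q1 p * q1 q - q2 p * q2 q - q3 p * q3 q)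
  (q0 p * q1 q + q1 p * q0 q + q2 p * q3 q - q3 p * q2 q)
  (q0 p * q2 q - q1 p * q3 q + q2 p * q0 q + q3 p * q1 q)
  (q0 p * q3 q + q1 p * q2 q - q2 p * q1 q + q3 p * q0 q).
Definition oneq : quaternion R := Quaternion 1 0 0 0.

Fact mulqA : associative mulq.
Proof. by case=> ? ? ? ? [? ? ? ?] [? ? ? ?]; congr Quaternion => /=; ring. Qed.
Fact mul1q : left_id oneq mulq.
Proof. by case=> ? ? ? ?; congr Quaternion => /=; ring. Qed.
Fact mulq1 : right_id oneq mulq.
Proof. by case=> ? ? ? ?; congr Quaternion => /=; ring. Qed.
Fact mulqDl : left_distributive mulq +%R.
Proof. by case=> ? ? ? ? [? ? ? ?] [? ? ? ?]; congr Quaternion => /=; ring. Qed.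
Fact mulqDr : right_distributive mulq +%R.
Proof. by case=> ? ? ? ? [? ? ? ?] [? ? ? ?]; congr Quaternion => /=; ring. Qed.
Fact oneq_neq0 : oneq != 0 :> quaternion R.
Proof. by apply/eqP => /(congr1 (@q0 R)) /eqP; rewrite /= oner_eq0. Qed.

HB.instance Definition _ := GRing.Zmodule_isNzRing.Build (quaternion R)
  mulqA mul1q mulq1 mulqDl mulqDr oneq_neq0.

Definition scaleq (a : R) q :=
  Quaternion (a * q0 q) (a * q1 q) (a * q2 q) (a * q3 q).

Fact scaleqA a b q : scaleq a (scaleq b q) = scaleq (a * b) q.
Proof. by rewrite /scaleq /= !mulrA. Qed.
Fact scale1q : left_id 1 scaleq.
Proof. by case=> ? ? ? ?; rewrite /scaleq /= !mul1r. Qed.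
Fact scaleqDr : right_distributive scaleq +%R.
Proof. by move=> a p q; congr Quaternion; rewrite /= mulrDr. Qed.
Fact scaleqDl q : {morph scaleq^~ q : a b / a + b}.
Proof. by move=> a b; congr Quaternion; rewrite /= mulrDl. Qed.

HB.instance Definition _ := GRing.Zmodule_isLmodule.Build R (quaternion R)
  scaleqA scale1q scaleqDr scaleqDl.

Fact scaleqAl (a : R) p q : a *: (p * q) = (a *: p) * q.
Proof. by case: p q => ? ? ? ? [? ? ? ?]; congr Quaternion => /=; ring. Qed.
HB.instance Definition _ :=
  GRing.Lmodule_isLalgebra.Build R (quaternion R) scaleqAl.

Fact scaleqAr (a : R) p q : a *: (p * q) = p * (a *: q).
Proof. by case: p q => ? ? ? ? [? ? ? ?]; congr Quaternion => /=; ring. Qed.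
HB.instance Definition _ :=
  GRing.Lalgebra_isAlgebra.Build R (quaternion R) scaleqAr.

End Algebra.

Notation lebesgue2 R := (@lebesgue_measure R \x @lebesgue_measure R)%E.

Section Analysis.
Variable R : realType.
Implicit Types (f g h : R * R -> quaternion R) (mu q : quaternion R).
Implicit Types x y : R * R.

(* Componentwise membership in L^1(R^2); `integrable` includes (Borel)
   measurability. *)
Definition qintegrable f : Prop :=
  [/\ (lebesgue2 R).-integrable setT (EFin \o (fun x => q0 (f x))),
      (lebesgue2 R).-integrable setT (EFin \o (fun x => q1 (f x))),
      (lebesgue2 R).-integrable setT (EFin \o (fun x => q2 (f x)))
    & (lebesgue2 R).-integrable setT (EFin \o (fun x => q3 (f x)))].

Definition qintegral f : quaternion R := Quaternion
  (\int[lebesgue2 R]_x q0 (f x)) (\int[lebesgue2 R]_x q1 (f x))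
  (\int[lebesgue2 R]_x q2 (f x)) (\int[lebesgue2 R]_x q3 (f x)).

Definition lmulqf q f : R * R -> quaternion R := fun x => q * f x.

Definition reflection (phi : bool * bool) f : R * R -> quaternion R :=
  fun x => f ((-1) ^+ phi.1 * x.1, (-1) ^+ phi.2 * x.2).

(* e^{mu t}; meaningful when mu ^+ 2 = -1. *)
Definition qexp mu (t : R) : quaternion R := (cos t)%:A + sin t *: mu.

Definition qfourier mu f : R * R -> quaternion R := fun y =>
  (2 * pi)^-1 *: qintegral (fun x => qexp mu (- (x.1 * y.1 + x.2 * y.2)) * f x).

Definition qconv f g : R * R -> quaternion R := fun x =>
  qintegral (fun y => f y * g (x.1 - y.1, x.2 - y.2)).

(* h represents 2 pi (F^mu)^-1 (F^mu f F^mu g). The inverse transform is taken in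
   the L^1 sense, since F^mu f F^mu g need not be integrable. Both sides being
   continuous in y, pointwise and a.e. equality agree. *)
Definition is_mustard mu f g h : Prop :=
  qintegrable h /\
  forall y, qfourier mu h y = (2 * pi) *: (qfourier mu f y * qfourier mu g y).

(* The chosen h is unique up to a.e. equality, by injectivity of F^mu on L^1. *)
Definition mustard mu f g : R * R -> quaternion R :=
  xget (fun=> 0) (is_mustard mu f g).

End Analysis.

(* Main.v *)
From HB Require Import structures.
Require Import Defs.
From mathcomp Require Import all_boot all_order all_algebra ring lra.
From mathcomp Require Import all_classical all_reals all_analysis.
From mathcomp Require Import measurable_realfun.
Import Order.TTheory GRing.Theory Num.Theory numFieldNormedType.Exports.
Local Open Scope classical_set_scope.
Local Open Scope ring_scope.

Set Implicit Arguments.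
Unset Strict Implicit.
Unset Printing Implicit Defensive.

(* Splitting e^{-mu t} into cos t and sin t gives F f = C f - mu (S f), where the
   cosine and sine transforms C and S commute with left and right multiplication
   by constants and satisfy the classical addition formulas on f * g. Expanding
   F f F g in C f, S f, C g and S g shows that
     (f * g - (mu f mu) * g + f * g^(1,1) + (mu f mu) * g^(1,1)) / 2
   is a Mustard convolution of f and g; in the four instances of the identity
   these representatives add up pointwise to 2 (f * g).
   They may replace the chosen Mustard convolutions because F is injective on L^1.
   This reduces to a real integrable h orthogonal to all cos (x . xi) and
   sin (x . xi). The bounded functions by which one can multiply every such h and
   stay in the same class form an algebra, closed under bounded pointwise limits
   and containing all these trigonometric functions; it contains the indicators
   of half-planes, hence of all Borel sets, and so h = 0 almost everywhere. *)

(** * Bernoulli inequalities and a polynomial approximation of the Heaviside step *)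

Section Bernoulli.
Variable R : realType.
Implicit Types t u v : R.

Lemma bernoulli_onem t N : 0 <= t <= 1 -> 1 - N%:R * t <= (1 - t) ^+ N.
Proof.
move=> /andP[t0 t1]; elim: N => [|N IH]; first by rewrite mul0r subr0 expr0.
rewrite exprS -natr1.
have : (1 - t) * (1 - N%:R * t) <= (1 - t) * (1 - t) ^+ N.
  by rewrite ler_wpM2l// subr_ge0.
apply: le_trans; have : 0 <= N%:R * (t * t) by rewrite !mulr_ge0.
nra.
Qed.

(** Companion of Bernoulli's inequality, in product form to avoid division. The induction rests on
    [(1 - t) * (1 + N.+1%:R * t) <= 1 + N%:R * t]. *)
Lemma bernoulli_onemM_le1 t N : 0 <= t <= 1 ->
  (1 - t) ^+ N * (1 + N%:R * t) <= 1.
Proof.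
move=> /andP[t0 t1]; elim: N => [|N IH].
  by rewrite mul0r addr0 expr0 mulr1.
apply: le_trans IH; rewrite exprSr -mulrA.
apply: ler_wpM2l; first by rewrite exprn_ge0// subr_ge0.
rewrite -natr1; have : 0 <= N%:R * (t * t) by rewrite !mulr_ge0.
nra.
Qed.

(* The second factor tends to 1, 1/e or 0 according to the sign of u; the first
   one kills the value 1/e at u = 0. *)
Definition step_approx (m : nat) u :=
  (1 - (1 - u * u) ^+ m) * (1 - ((1 - u) / 2) ^+ m) ^+ (2 ^ m).

Lemma step_approx_bound m u : `|u| <= 1 -> `|step_approx m u| <= 1.
Proof.
rewrite ler_norml => /andP[u0 u1].
have h w : 0 <= w <= 1 -> 0 <= 1 - w ^+ m <= 1.
  move=> /andP[w0 w1]; rewrite subr_ge0 exprn_ile1//=.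
  by rewrite lerBlDr lerDl exprn_ge0.
have /andP[a0 a1] : 0 <= 1 - (1 - u * u) ^+ m <= 1 by apply: h; nra.
have /andP[b0 b1] : 0 <= 1 - ((1 - u) / 2) ^+ m <= 1 by apply: h; lra.
rewrite /step_approx ger0_norm; last by rewrite mulr_ge0// exprn_ge0.
by rewrite mulr_ile1// ?exprn_ge0// exprn_ile1.
Qed.

(** The exponents are matched: with v = (1 - u) / 2, the product of 2 ^ m and v ^ m is (1 - u) ^ m,
    which tends to 0 for u > 0 and to infinity for u < 0. The two Bernoulli estimates turn this into
    the limits 1 and 0 of the second factor. *)
Lemma cvg_step_approx u : `|u| <= 1 ->
  step_approx ^~ u @ \oo --> ((0 < u)%R%:R : R).
Proof.
move=> u1.
have [->|un0] := eqVneq u 0.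
  rewrite ltxx; under eq_fun do
    rewrite /step_approx mul0r subr0 expr1n subrr mul0r.
  exact: cvg_cst.
have /andP[um1 u1'] : -1 <= u <= 1 by rewrite -ler_norml.
have cvg1 : (fun m => 1 - (1 - u * u) ^+ m) @ \oo --> (1 : R).
  rewrite -[X in _ --> X]subr0; apply: cvgB; first exact: cvg_cst.
  apply: cvg_expr; have : 0 < u * u by rewrite -expr2 exprn_even_gt0.
  by move=> ?; rewrite ltr_norml; apply/andP; split; nra.
rewrite -[X in _ --> X]mul1r; apply: cvgM => //.
set v := (1 - u) / 2.
have v01 : 0 <= v <= 1 by rewrite /v; apply/andP; split; lra.
have vm01 m : 0 <= v ^+ m <= 1.
  by case/andP: v01 => v0 v1; rewrite exprn_ge0//= exprn_ile1.
have powE m : (2 ^ m)%:R * v ^+ m = (2 * v) ^+ m :> R.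
  by rewrite natrX [RHS]exprMn.
case: (ltP 0 u) => [u_gt0|u_le0] /=.
- apply: (@squeeze_cvgr _ _ _ _ (fun m => 1 - (2 * v) ^+ m) (cst 1)).
  + apply: nearW => m; rewrite -powE bernoulli_onem//=.
    by case/andP: (vm01 m) => ? ?; rewrite exprn_ile1//; lra.
  + rewrite -[X in _ --> X]subr0; apply: cvgB; first exact: cvg_cst.
    by apply: cvg_expr; rewrite ltr_norml /v; apply/andP; split; lra.
  + exact: cvg_cst.
- have u_lt0 : u < 0 by rewrite lt_neqAle un0.
  have v2 : 1 < 2 * v by rewrite /v; lra.
  apply: (@squeeze_cvgr _ _ _ _ (cst 0) (fun m => (2 * v)^-1 ^+ m)).
  + apply: nearW => m; have /andP[? ?] := vm01 m.
    have ? : 0 <= 1 - v ^+ m by lra.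
    rewrite exprn_ge0//= exprVn -[leRHS]mul1r.
    have p0 : 0 < (2 * v) ^+ m by rewrite exprn_gt0//; lra.
    rewrite ler_pdivlMr//; apply: le_trans (bernoulli_onemM_le1 (2 ^ m) (vm01 m)).
    by rewrite -powE ler_wpM2l ?exprn_ge0// lerDr.
  + exact: cvg_cst.
  + apply: cvg_expr; rewrite ger0_norm ?invr_ge0; last by lra.
    by rewrite invf_lt1//; lra.
Qed.

End Bernoulli.

(** * The algebra of multipliers preserving orthogonality to a class of bounded functions *)

Section Multiplier.
Context d (T : measurableType d) (R : realType).
Variable mu : {measure set T -> \bar R}.
Implicit Types (phi h : T -> R).

Definition bounded_measurable phi :=
  measurable_fun setT phi /\ exists B, forall x, `|phi x| <= B.

Lemma integrable_mul_bounded h phi : mu.-integrable setT (EFin \o h) ->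
  bounded_measurable phi ->
  mu.-integrable setT (EFin \o (fun x => h x * phi x)).
Proof.
move=> ih [mphi [B phiB]].
have mh : measurable_fun setT h by apply/measurable_EFinP; case/integrableP: ih.
apply: (@le_integrable _ _ _ mu setT measurableT _ (fun x => B%:E * (h x)%:E)%E).
- by apply/measurable_EFinP; exact: measurable_funM.
- move=> x _; rewrite -EFinM /= lee_fin !normrM mulrC ler_wpM2r//.
  by rewrite (le_trans (phiB x))// ler_norm.
- exact: integrableZl.
Qed.

Variable G : set (T -> R).
Hypothesis bG : forall g, G g -> bounded_measurable g.

Definition annihilates h := forall g, G g -> \int[mu]_x (h x * g x) = 0.

(** Quantifying over all integrable h, rather than fixing one, makes multipliers closed under
    products: multiplying by one of them yields another admissible h. *)
Definition multiplier phi := bounded_measurable phi /\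
  forall h, mu.-integrable setT (EFin \o h) -> annihilates h ->
    annihilates (fun x => h x * phi x).

Lemma multiplier_cst c : multiplier (cst c).
Proof.
split; first by split; [exact: measurable_cst|exists `|c|].
move=> h ih hG g /[dup] Gg /bG bg.
under eq_Rintegral do rewrite mulrAC.
by rewrite RintegralZr// ?(hG _ Gg) ?mul0r//; exact: integrable_mul_bounded.
Qed.

Lemma multiplierM phi psi : multiplier phi -> multiplier psi ->
  multiplier (fun x => phi x * psi x).
Proof.
move=> [[mphi [B phiB]] hphi] [[mpsi [C psiC]] hpsi]; split.
  split; first exact: measurable_funM.
  by exists (B * C) => x; rewrite normrM ler_pM.
move=> h ih hG; have := hpsi _ _ (hphi _ ih hG).
have -> : (fun x => h x * phi x * psi x) = (fun x => h x * (phi x * psi x)).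
  by apply/funext => x; rewrite mulrA.
by apply; apply: integrable_mul_bounded => //; split => //; exists B.
Qed.

Lemma multiplierD phi psi : multiplier phi -> multiplier psi ->
  multiplier (fun x => phi x + psi x).
Proof.
move=> [[mphi [B phiB]] hphi] [[mpsi [C psiC]] hpsi]; split.
  split; first exact: measurable_funD.
  by exists (B + C) => x; rewrite (le_trans (ler_normD _ _))// lerD.
move=> h ih hG g /[dup] Gg /bG bg.
under eq_Rintegral do rewrite mulrDr mulrDl.
rewrite RintegralD//.
- by rewrite (hphi _ ih hG _ Gg) (hpsi _ ih hG _ Gg) addr0.
- by do 2! (apply: integrable_mul_bounded => //); split => //; exists B.
- by do 2! (apply: integrable_mul_bounded => //); split => //; exists C.
Qed.

Lemma multiplierB phi psi : multiplier phi -> multiplier psi ->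
  multiplier (fun x => phi x - psi x).
Proof.
move=> mphi mpsi; have := multiplierD mphi (multiplierM (multiplier_cst (-1)) mpsi).
by under [X in multiplier X]eq_fun do rewrite mulN1r.
Qed.

Lemma multiplierX phi n : multiplier phi -> multiplier (fun x => phi x ^+ n).
Proof.
move=> mphi; elim: n => [|n IH]; first exact: (multiplier_cst 1).
by under eq_fun do rewrite exprS; exact: multiplierM.
Qed.

(** Dominated convergence with majorant |h| * (B * C), where C bounds the test function g: all the
    approximating integrals vanish, hence so does the limit. *)
Lemma multiplier_lim (phi_ : nat -> T -> R) phi B :
  (forall n, multiplier (phi_ n)) -> (forall n x, `|phi_ n x| <= B) ->
  (forall x, phi_ ^~ x @ \oo --> phi x) -> multiplier phi.
Proof.
move=> mphi phiB phi_cvg.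
have mlim : measurable_fun setT phi.
  by apply: (measurable_fun_cvg (fun n => (mphi n).1.1)) => x _; exact: phi_cvg.
have phiB' x : `|phi x| <= B.
  by apply: (cvgr_to_le (cvg_norm (phi_cvg x))); exact: nearW.
split; first by split => //; exists B.
move=> h ih hG g /[dup] Gg /bG [mg [C gC]].
have mh : measurable_fun setT h by apply/measurable_EFinP; case/integrableP: ih.
have [] := @dominated_convergence _ T R mu setT measurableT
  (fun n x => (h x * phi_ n x * g x)%:E) (fun x => (h x * phi x * g x)%:E)
  (fun x => (`|h x| * (B * C))%:E).
- move=> n; apply/measurable_EFinP; apply: measurable_funM => //.
  by apply: measurable_funM => //; exact: (mphi n).1.1.
- by apply/measurable_EFinP; do 2! (apply: measurable_funM => //).
- apply: aeW => x _; apply: cvg_EFin; first exact: nearW.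
  by apply: cvgM; [apply: cvgM; [exact: cvg_cst|exact: phi_cvg]|exact: cvg_cst].
- apply: (@integrable_mul_bounded (fun x => `|h x|)); first exact: integrable_norm.
  by split; [exact: measurable_cst|exists `|B * C|].
- apply: aeW => x n _; rewrite lee_fin -mulrA !normrM ler_wpM2l//.
  by rewrite ler_pM.
move=> _ _; rewrite /Rintegral (_ : [sequence _]_n = cst 0%E); last first.
  apply/funext => n /=; rewrite -[LHS]fineK; last first.
    apply: integrable_fin_num => //.
    apply: (@integrable_mul_bounded (fun x => h x * phi_ n x)).
      by apply: integrable_mul_bounded => //; exact: (mphi n).1.
    by split => //; exists C.
  by have := (mphi n).2 _ ih hG _ Gg; rewrite /Rintegral => ->.
by move/(cvg_lim (@ereal_hausdorff R)); rewrite lim_cst => // <-.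
Qed.

(** Each [step_approx m] is a polynomial, so its composition with u stays in the algebra; the
    uniform bound 1 allows passing to the pointwise limit. *)
Lemma multiplier_pos u : multiplier u -> (forall x, `|u x| <= 1) ->
  multiplier (fun x => (0 < u x)%R%:R : R).
Proof.
move=> mu1 u1; apply: (@multiplier_lim (fun m x => step_approx m (u x)) _ 1).
- move=> m; apply: multiplierM.
    apply: multiplierB; first exact: (multiplier_cst 1).
    apply: multiplierX; apply: multiplierB; first exact: (multiplier_cst 1).
    exact: multiplierM.
  apply: multiplierX; apply: multiplierB; first exact: (multiplier_cst 1).
  apply: multiplierX; apply: multiplierM; last exact: (multiplier_cst 2^-1).
  by apply: multiplierB => //; exact: (multiplier_cst 1).
- by move=> n x; exact: step_approx_bound.
- by move=> x; exact: cvg_step_approx.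
Qed.

Definition multiplier_set : set (set T) := [set A | multiplier (\1_A : T -> R)].

(** A complement has indicator 1 minus the given one. A countable union is the limit of finite
    unions, whose indicators are 1 minus a product of complementary indicators and stay between 0
    and 1. *)
Lemma sigma_algebra_multiplier_set : sigma_algebra setT multiplier_set.
Proof.
split.
- by rewrite /multiplier_set /= indic0; exact: (multiplier_cst 0).
- move=> A mA; rewrite /multiplier_set /= setTD.
  rewrite (_ : \1_(~` A) = (fun x => 1 - \1_A x)); last first.
    by apply/funext => x; rewrite !indicE in_setC; case: (_ \in _); rewrite ?subrr ?subr0.
  by apply: multiplierB => //; exact: (multiplier_cst 1).
move=> A mA; rewrite /multiplier_set /=.
apply: (@multiplier_lim (fun n x => 1 - \prod_(i < n) (1 - \1_(A i) x)) _ 1).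
- move=> n; apply: multiplierB; first exact: (multiplier_cst 1).
  elim: n => [|n IH].
    by under eq_fun do rewrite big_ord0; exact: (multiplier_cst 1).
  under eq_fun do rewrite big_ord_recr /=; apply: multiplierM => //.
  by apply: multiplierB; [exact: (multiplier_cst 1)|exact: mA].
- move=> n x; have /andP[p0 p1] : 0 <= \prod_(i < n) (1 - \1_(A i) x : R) <= 1.
    rewrite prodr_ge0 ?prodr_ile1// => i _; rewrite indicE; case: (_ \in _);
      by rewrite ?subrr ?subr0 ?lexx ?ler01.
  by rewrite ler_norml; apply/andP; split; lra.
- move=> x; rewrite indicE; case: (boolP (_ \in _)) => [/set_mem[k _ Akx]|/negP nAx] /=.
    (* Once n exceeds an index k with x in [A k], the k-th factor is 0. *)
    apply: cvg_near_cst; near=> n.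
    have kn : (k < n)%N by near: n; exact: nbhs_infty_gt.
    by rewrite (bigD1 (Ordinal kn))//= indicE mem_set// subrr mul0r subr0.
  under eq_fun => n.
    rewrite big1; last first.
      move=> i _; rewrite indicE memNset ?subr0// => Aix.
      by apply: nAx; rewrite inE; exists i.
    over.
  by rewrite subrr; exact: cvg_cst.
Unshelve. all: by end_near.
Qed.

End Multiplier.

(** * Measure-preserving maps: products, translations, reflections *)

Definition measure_preserving d (T : measurableType d) (R : realType)
    (mu : set T -> \bar R) (phi : T -> T) :=
  measurable_fun setT phi /\
  forall A, measurable A -> mu (phi @^-1` A) = mu A.

Section MeasurePreserving.
Context d (T : measurableType d) (R : realType).
Variables (mu : {measure set T -> \bar R}) (phi : T -> T).
Hypothesis phiP : measure_preserving mu phi.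

(** The pushforward of [mu] by [phi] coincides with [mu] on measurable sets, so this is change of
    variables for a pushforward. *)
Lemma ge0_integral_measure_preserving (f : T -> \bar R) :
  measurable_fun setT f -> (forall x, 0 <= f x)%E ->
  (\int[mu]_x f (phi x) = \int[mu]_x f x)%E.
Proof.
move=> mf f0; case: phiP => mphi muphi.
transitivity (\int[pushforward mu phi]_x f x)%E.
  by rewrite (ge0_integral_pushforward mphi)//= preimage_setT.
by apply: eq_measure_integral => A mA _; exact: muphi.
Qed.

Lemma integrable_measure_preserving (f : T -> \bar R) :
  mu.-integrable setT f -> mu.-integrable setT (f \o phi).
Proof.
case: phiP => mphi _ /integrableP[mf foo]; apply/integrableP; split.
  exact: measurableT_comp.
rewrite (ge0_integral_measure_preserving (f := fun x => `|f x|%E))//.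
exact: measurableT_comp.
Qed.

Lemma integral_measure_preserving (f : T -> \bar R) :
  mu.-integrable setT f -> (\int[mu]_x f (phi x) = \int[mu]_x f x)%E.
Proof.
move=> fi; case: phiP => mphi muphi.
have [mf _] := integrableP _ _ _ fi.
transitivity (\int[pushforward mu phi]_x f x)%E.
  rewrite (integral_pushforward mphi)//= preimage_setT//.
  exact: integrable_measure_preserving.
by apply: eq_measure_integral => A mA _; exact: muphi.
Qed.

Lemma Rintegral_measure_preserving (f : T -> R) :
  mu.-integrable setT (EFin \o f) ->
  \int[mu]_x f (phi x) = \int[mu]_x f x.
Proof. by move=> fi; rewrite /Rintegral (integral_measure_preserving fi). Qed.

End MeasurePreserving.

(** The pushforward of the product measure has the right value on rectangles, and sigma-finiteness
    makes the product measure unique. *)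
Lemma measure_preservingX d1 d2 (T1 : measurableType d1) (T2 : measurableType d2)
    (R : realType) (m1 : {sigma_finite_measure set T1 -> \bar R})
    (m2 : {sigma_finite_measure set T2 -> \bar R}) phi1 phi2 :
  measure_preserving m1 phi1 -> measure_preserving m2 phi2 ->
  measure_preserving (m1 \x m2)%E (fun x => (phi1 x.1, phi2 x.2)).
Proof.
move=> [mphi1 h1] [mphi2 h2].
have mphi : measurable_fun setT (fun x : T1 * T2 => (phi1 x.1, phi2 x.2)).
  by apply: measurable_fun_pair; exact: measurableT_comp.
split => // A mA; apply/esym.
pose m' := measure_function_pushforward__canonical__measure_function_Measure
  (m1 \x m2)%E mphi.
apply: (product_measure_unique (m' := m')) => // B C mB mC.
rewrite /= /pushforward -h1// -h2// -product_measure1E//.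
- by rewrite -[X in measurable X]setTI; exact: mphi1.
- by rewrite -[X in measurable X]setTI; exact: mphi2.
Qed.

(** Lebesgue measure is determined by its values on half-open intervals, and a translate of such an
    interval has the same length. *)
Lemma lebesgue_translation (R : realType) (a : R) :
  measure_preserving (@lebesgue_measure R) (fun x => x + a).
Proof.
have ma : measurable_fun [set: measurableTypeR R]
    (fun x => x + a : measurableTypeR R).
  exact: measurable_funD.
split => // A mA; apply/esym.
pose m' := measure_function_pushforward__canonical__measure_function_Measure
  (@lebesgue_measure R) ma.
apply: (lebesgue_measure_unique (mu := m')) => // _ [[b c] _ <-] /=.
rewrite /pushforward (_ : _ @^-1` _ = `]b - a, c - a]%classic); last first.
  by apply/seteqP; split => x /=; rewrite !in_itv/= ltrBlDr lerBrDr.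
rewrite !lebesgue_measure_itv/= !lte_fin ltrD2r; case: ifP => // _.
by rewrite -!EFinB; congr EFin; ring.
Qed.

(** Same uniqueness argument; the reflected interval is closed on the left and open on the right,
    which leaves its length unchanged. *)
Lemma lebesgue_opp (R : realType) : measure_preserving (@lebesgue_measure R) -%R.
Proof.
have mN : measurable_fun [set: measurableTypeR R]
    (fun x => - x : measurableTypeR R).
  exact: measurable_funN.
split => // A mA; apply/esym.
pose m' := measure_function_pushforward__canonical__measure_function_Measure
  (@lebesgue_measure R) mN.
apply: (lebesgue_measure_unique (mu := m')) => // _ [[b c] _ <-] /=.
rewrite /pushforward (_ : _ @^-1` _ = `[- c, - b[%classic); last first.
  by apply/seteqP; split => x /=; rewrite !in_itv/= andbC lerNl ltrNr.
rewrite !lebesgue_measure_itv/= !lte_fin ltrN2; case: ifP => // _.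
by congr EFin; rewrite !opprK addrC.
Qed.

(** * Sine and cosine transforms on the plane and their joint injectivity *)

Section Plane.
Variable R : realType.
Local Notation plane := (measurableTypeR R * measurableTypeR R)%type.
Local Notation leb2 := (lebesgue2 R).
Implicit Types (h : R * R -> R) (x y xi eta : R * R).

Definition dot x y := x.1 * y.1 + x.2 * y.2.

Lemma dotZr t x xi : dot x (t * xi.1, t * xi.2) = t * dot x xi.
Proof. by rewrite /dot /=; ring. Qed.

Lemma dotNr x xi : dot x (- xi.1, - xi.2) = - dot x xi.
Proof. by rewrite /dot /=; ring. Qed.

Lemma measurable_dot xi : measurable_fun [set: plane] (dot^~ xi).
Proof.
by apply: measurable_funD; apply: measurable_funM.
Qed.

Lemma bounded_measurable_cos_dot xi :
  bounded_measurable (T := plane) (fun x => cos (dot x xi)).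
Proof.
split; last by exists 1 => x; exact: cos_max.
apply: (measurableT_comp (f := cos)); last exact: measurable_dot.
by apply: continuous_measurable_fun; exact: continuous_cos.
Qed.

Lemma bounded_measurable_sin_dot xi :
  bounded_measurable (T := plane) (fun x => sin (dot x xi)).
Proof.
split; last by exists 1 => x; exact: sin_max.
apply: (measurableT_comp (f := sin)); last exact: measurable_dot.
by apply: continuous_measurable_fun; exact: continuous_sin.
Qed.

Definition cos_transform h xi := \int[leb2]_x (h x * cos (dot x xi)).
Definition sin_transform h xi := \int[leb2]_x (h x * sin (dot x xi)).

Definition characters : set (plane -> R) :=
  [set g | exists xi, g = (fun x => cos (dot x xi)) \/
                      g = (fun x => sin (dot x xi))].

Lemma characters_bounded g : characters g -> bounded_measurable (T := plane) g.
Proof.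
by move=> [xi [->|->]]; [exact: bounded_measurable_cos_dot|
  exact: bounded_measurable_sin_dot].
Qed.

Lemma annihilates_characters h :
  (forall xi, cos_transform h xi = 0) -> (forall xi, sin_transform h xi = 0) ->
  annihilates leb2 characters h.
Proof. by move=> c0 s0 _ [xi [->|->]]; [exact: c0|exact: s0]. Qed.

Lemma Rintegral_half_sum (f g : plane -> R) :
  leb2.-integrable setT (EFin \o f) -> leb2.-integrable setT (EFin \o g) ->
  \int[leb2]_x (2^-1 * (f x + g x)) =
    2^-1 * (\int[leb2]_x f x + \int[leb2]_x g x).
Proof.
move=> fi gi; rewrite RintegralZl//; first by rewrite RintegralD.
exact: (integrableD measurableT fi gi).
Qed.

Let dotBr x xi eta : dot x (xi.1 - eta.1, xi.2 - eta.2) = dot x xi - dot x eta.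
Proof. by rewrite /dot /=; ring. Qed.
Let dotDr x xi eta : dot x (xi.1 + eta.1, xi.2 + eta.2) = dot x xi + dot x eta.
Proof. by rewrite /dot /=; ring. Qed.

(** Product-to-sum formulas: cos or sin at frequency xi times cos at eta is a half-sum of the same
    function at xi + eta and xi - eta, both orthogonal to h. *)
Lemma multiplier_cos_dot eta : multiplier leb2 characters (fun x => cos (dot x eta)).
Proof.
split; first exact: bounded_measurable_cos_dot.
move=> h hi h0 _ [xi [->|->]].
- pose f s x := h x * cos (dot x (xi.1 + s * eta.1, xi.2 + s * eta.2)).
  have fi s : leb2.-integrable setT (EFin \o f s).
    exact: (integrable_mul_bounded hi (bounded_measurable_cos_dot
      (xi.1 + s * eta.1, xi.2 + s * eta.2))).
  transitivity (\int[leb2]_x (2^-1 * (f 1 x + f (-1) x))).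
    apply: eq_Rintegral => x _; rewrite /f !mul1r !mulN1r dotBr dotDr
      (cosB (dot x xi)) (cosD (dot x xi)).
    by field.
  rewrite Rintegral_half_sum; [|exact: fi..].
  by rewrite !h0 ?addr0 ?mulr0//; eexists; left.
- pose f s x := h x * sin (dot x (xi.1 + s * eta.1, xi.2 + s * eta.2)).
  have fi s : leb2.-integrable setT (EFin \o f s).
    exact: (integrable_mul_bounded hi (bounded_measurable_sin_dot
      (xi.1 + s * eta.1, xi.2 + s * eta.2))).
  transitivity (\int[leb2]_x (2^-1 * (f 1 x + f (-1) x))).
    apply: eq_Rintegral => x _; rewrite /f !mul1r !mulN1r dotBr dotDr
      (sinB (dot x xi)) (sinD (dot x xi)).
    by field.
  rewrite Rintegral_half_sum; [|exact: fi..].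
  by rewrite !h0 ?addr0 ?mulr0//; eexists; right.
Qed.

(** Product-to-sum again; a sine factor exchanges the two kinds of character and makes the two terms
    enter with opposite signs, carried here by s. *)
Lemma multiplier_sin_dot eta : multiplier leb2 characters (fun x => sin (dot x eta)).
Proof.
split; first exact: bounded_measurable_sin_dot.
move=> h hi h0 _ [xi [->|->]].
- pose f s x := h x * (s * sin (dot x (xi.1 + s * eta.1, xi.2 + s * eta.2))).
  transitivity (\int[leb2]_x (2^-1 * (f 1 x + f (-1) x))).
    apply: eq_Rintegral => x _; rewrite /f !mul1r !mulN1r dotBr dotDr
      (sinB (dot x xi)) (sinD (dot x xi)).
    by field.
  have ki s := integrable_mul_bounded hi (bounded_measurable_sin_dot
    (xi.1 + s * eta.1, xi.2 + s * eta.2)).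
  have fE s : f s = fun x => s * (h x *
    sin (dot x (xi.1 + s * eta.1, xi.2 + s * eta.2))).
    by apply/funext => x; rewrite /f mulrCA.
  have fi s : leb2.-integrable setT (EFin \o f s).
    by rewrite fE; exact: (integrableZl measurableT s (ki s)).
  rewrite Rintegral_half_sum// !fE !RintegralZl// !h0 ?mulr0 ?addr0 ?mulr0//;
    by eexists; right.
- pose f s x := h x * (- s * cos (dot x (xi.1 + s * eta.1, xi.2 + s * eta.2))).
  transitivity (\int[leb2]_x (2^-1 * (f 1 x + f (-1) x))).
    apply: eq_Rintegral => x _; rewrite /f !mul1r !mulN1r dotBr dotDr
      (cosB (dot x xi)) (cosD (dot x xi)).
    by field.
  have ki s := integrable_mul_bounded hi (bounded_measurable_cos_dot
    (xi.1 + s * eta.1, xi.2 + s * eta.2)).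
  have fE s : f s = fun x => - s * (h x *
    cos (dot x (xi.1 + s * eta.1, xi.2 + s * eta.2))).
    by apply/funext => x; rewrite /f mulrCA.
  have fi s : leb2.-integrable setT (EFin \o f s).
    by rewrite fE; exact: (integrableZl measurableT (- s) (ki s)).
  rewrite Rintegral_half_sum// !fE !RintegralZl// !h0 ?mulr0 ?addr0 ?mulr0//;
    by eexists; left.
Qed.

(* On the right half-plane sin ((dot x eta - a) / n) is eventually positive. *)
Lemma multiplier_half_plane a eta :
  multiplier leb2 characters (\1_[set x | a < dot x eta] : plane -> R).
Proof.
have bG := characters_bounded.
apply: (@multiplier_lim _ _ _ leb2 _ bG
  (fun n x => (0 < sin ((dot x eta - a) / n.+1%:R))%R%:R) _ 1).
- move=> n; apply: (multiplier_pos bG); last by move=> x; exact: sin_max.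
  pose t : R := n.+1%:R^-1.
  (* The subtraction formula leaves characters of frequency t * eta with constant coefficients. *)
  rewrite (_ : (fun x => _) = fun x =>
    sin (dot x (t * eta.1, t * eta.2)) * cst (cos (a * t)) x -
    cos (dot x (t * eta.1, t * eta.2)) * cst (sin (a * t)) x); last first.
    by apply/funext => x /=; rewrite dotZr mulrBl sinB (mulrC t).
  apply: (multiplierB bG); apply: (multiplierM);
    by [exact: multiplier_sin_dot|exact: multiplier_cos_dot|exact: multiplier_cst].
- by move=> n x; case: (0 < _)%R; rewrite ?normr1 ?normr0.
- move=> x; apply: cvg_near_cst; near=> n.
  pose u := dot x eta - a; rewrite -/u.
  (* Once |u| < n + 1, the quotient lies in ]-1, 1[, hence within ]-pi/2, pi/2[, where sine has the
     sign of its argument. *)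
  have un : `|u| < n.+1%:R.
    have un : `|u| < n%:R by near: n; exact: nbhs_infty_gtr.
    by rewrite (lt_trans un)// ltr_nat.
  have [un1 un2] : u / n.+1%:R < 1 /\ - u / n.+1%:R < 1.
    by rewrite !ltr_pdivrMr// !mul1r; split; apply: le_lt_trans (ler_norm _) _;
      rewrite ?normrN.
  have pi1 : 1 <= pi / 2 :> R := pihalf_ge1 R.
  rewrite indicE; case: (boolP (_ \in _)) => [/set_mem /= ax|nax].
    by rewrite sin_gt0_pihalf// divr_gt0 ?subr_gt0//= (lt_le_trans un1).
  have : u <= 0.
    by rewrite subr_le0 leNgt; apply: contra nax => ax; rewrite inE.
  rewrite le_eqVlt => /predU1P[->|u0]; first by rewrite mul0r sin0 ltxx.
  have : 0 < sin (- (u / n.+1%:R)).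
    by rewrite sin_gt0_pihalf// -mulNr divr_gt0 ?oppr_gt0//= (lt_le_trans un2).
  by rewrite sinN oppr_gt0 => /lt_gtF ->.
Unshelve. all: by end_near.
Qed.

(** The sets B of reals whose preimage under [dot^~ eta] is a multiplier set form a sigma-algebra;
    it contains the rays ]a, +oo[, which generate the Borel sets. *)
Lemma multiplier_measurable_strip eta (A : set (measurableTypeR R)) : measurable A ->
  multiplier_set leb2 characters [set x : plane | A (dot x eta)].
Proof.
have bG := characters_bounded.
have [s0 sC sU] := sigma_algebra_multiplier_set leb2 bG.
have mE := RGenOInfty.measurableE R.
move=> mA; have : (@ocitv R).-sigma.-measurable A by exact: mA.
rewrite mE; apply: (smallest_sub (X := [set B : set R |
  multiplier_set leb2 characters [set x : plane | B (dot x eta)]])).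
- split; first exact: s0.
  + by move=> B /sC; rewrite !setTD.
  + move=> B /sU; congr multiplier_set; apply/seteqP; split=> [x [k _ ?]|x [k _ ?]];
      by exists k.
- move=> _ [a ->]; have := multiplier_half_plane a eta.
  rewrite /multiplier_set/=; congr (multiplier _ _ (\1_ _)).
  by apply/seteqP; split => x /=; rewrite in_itv/= andbT.
Qed.

(** The product sigma-algebra is generated by preimages under the two coordinates, which are [dot]
    with (1, 0) and (0, 1). *)
Lemma multiplier_measurable (A : set plane) : measurable A ->
  multiplier_set leb2 characters A.
Proof.
have sS := sigma_algebra_multiplier_set leb2 characters_bounded.
apply: smallest_sub => // _ [] [B mB <-]; rewrite setTI.
- rewrite (_ : _ @^-1` _ = [set x : plane | B (dot x (1, 0))]).
    exact: multiplier_measurable_strip.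
  by apply/seteqP; split => x /=; rewrite /dot /= mulr1 mulr0 addr0.
- rewrite (_ : _ @^-1` _ = [set x : plane | B (dot x (0, 1))]).
    exact: multiplier_measurable_strip.
  by apply/seteqP; split => x /=; rewrite /dot /= mulr1 mulr0 add0r.
Qed.

Lemma trig_transform_injective h : leb2.-integrable setT (EFin \o h) ->
  (forall xi, cos_transform h xi = 0) -> (forall xi, sin_transform h xi = 0) ->
  {ae leb2, forall x, h x = 0}.
Proof.
move=> hi c0 s0; have h0 := annihilates_characters c0 s0.
have : ae_eq leb2 setT (EFin \o h) (cst 0%E).
  apply: integral_ae_eq => // A _ mA; rewrite integral0.
  have [[mA1 [B A1B]] AP] := multiplier_measurable mA.
  have H : \int[leb2]_x (h x * \1_A x) = 0.
    (* At frequency 0 the cosine is 1, so the multiplier property of A yields a zero integral of h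
       over A. *)
    have := AP _ hi h0 _ (ex_intro _ (0, 0) (or_introl erefl)).
    by under eq_Rintegral do rewrite /dot /= !mulr0 addr0 cos0 mulr1.
  rewrite integral_mkcond restrict_EFin patch_indic.
  rewrite -[LHS]fineK; first by congr EFin; exact: H.
  apply: integrable_fin_num => //; apply: integrable_mul_bounded => //.
  by split => //; exists B.
apply: filterS => x /(_ I) /=; by case.
Qed.

End Plane.

(** * Marginals of an integrable function of two variables *)

Section Marginal.
Context d1 d2 (T1 : measurableType d1) (T2 : measurableType d2) (R : realType).
Variables (m1 : {sigma_finite_measure set T1 -> \bar R}).
Variables (m2 : {sigma_finite_measure set T2 -> \bar R}).
Variable K : T1 * T2 -> R.
Hypothesis Ki : (m1 \x m2)%E.-integrable setT (EFin \o K).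

Let measurable_marginal :
  measurable_fun setT (fun x => \int[m2]_y K (x, y)).
Proof.
apply: (measurableT_comp (f := fine)); first exact: fine_measurable.
exact: (measurable_fubini_F Ki).
Qed.

Lemma integrable_marginal :
  m1.-integrable setT (EFin \o (fun x => \int[m2]_y K (x, y))).
Proof.
apply: (le_integrable measurableT _ _ (integrable_fubini_F Ki)).
  exact/measurable_EFinP.
(* [fine] sends infinite values to 0, so it can only decrease the absolute value. *)
move=> x _; rewrite /= /Rintegral /fubini_F /=.
by case: (\int[m2]_y _)%E => [r||] //=; rewrite normr0 leey.
Qed.

Lemma Rintegral_marginalM phi : bounded_measurable phi ->
  \int[m1]_x ((\int[m2]_y K (x, y)) * phi x) =
  \int[(m1 \x m2)%E]_z (K z * phi z.1).
Proof.
move=> [mphi [B phiB]].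
have Kphi : (m1 \x m2)%E.-integrable setT (EFin \o (fun z => K z * phi z.1)).
  apply: integrable_mul_bounded => //; split; last by exists B.
  by apply: measurableT_comp.
rewrite /Rintegral -(integral12_prod_meas1 Kphi); congr fine.
apply: ae_eq_integral => //.
- apply/measurable_EFinP; apply: measurable_funM => //.
- exact: (measurable_fubini_F Kphi).
(* The factor [phi x] is pulled out where the section of K at x is integrable, that is, almost
   everywhere. *)
apply: filterS (ae_integrable1 Ki) => x Kx _ /=.
rewrite /fubini_F /= -[RHS]fineK; last first.
  apply: integrable_fin_num => //.
  apply: (@integrable_mul_bounded _ _ _ _ (fun y => K (x, y))) => //.
  by split; [exact: measurable_cst|exists B].
by congr EFin; rewrite -RintegralZr.
Qed.

End Marginal.

(** * Real convolution kernels on the plane and their addition formulas *)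

Lemma sigma_finite_lebesgue2 (R : realType) : sigma_finite setT (lebesgue2 R).
Proof.
exists (fun n => `[- n%:R, n%:R]%classic `*` `[- n%:R, n%:R]%classic) => [|n].
  apply/esym; rewrite -subTset => x _.
  exists (Num.truncn (Num.max `|x.1| `|x.2|)).+1 => //.
  by split => /=; rewrite in_itv/= -ler_norml ltW// (le_lt_trans _ (truncnS_gt _))//
    le_max lexx ?orbT.
split; first by apply: measurableX; exact: measurable_itv.
rewrite product_measure1E; [|exact: measurable_itv..].
rewrite [X in (X * X)%E]lebesgue_measure_itv/=.
by case: ifP => _; rewrite ?mule0// -!EFinD -EFinM ltry.
Qed.

(* The library leaves the sigma-finiteness of a product out of reach of
   canonical structure inference, behind that of a product of subprobabilities. *)
Definition plane_measure (R : realType) : {sigma_finite_measure set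
    (measurableTypeR R * measurableTypeR R)%type -> \bar R} :=
  HB.pack (lebesgue2 R)
    (Measure_isSigmaFinite.Build _ _ _ _ (sigma_finite_lebesgue2 R)).

Section Kernel.
Variable R : realType.
Local Notation plane := (measurableTypeR R * measurableTypeR R)%type.
Local Notation leb2 := (lebesgue2 R).
Local Notation leb4 := (plane_measure R \x plane_measure R)%E.
Implicit Types (f g : R * R -> R) (x y xi : R * R).

Lemma plane_translation y :
  measure_preserving leb2 (fun x : plane => (x.1 - y.1, x.2 - y.2)).
Proof.
exact: (measure_preservingX (lebesgue_translation (- y.1))
  (lebesgue_translation (- y.2))).
Qed.

Lemma plane_opp : measure_preserving leb2 (fun x : plane => (- x.1, - x.2)).
Proof. exact: (measure_preservingX (lebesgue_opp R) (lebesgue_opp R)). Qed.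

(** Output point first, integration variable second: integrating out the second variable gives the
    convolution. *)
Definition kernel f g : plane * plane -> R :=
  fun z => f z.2 * g (z.1.1 - z.2.1, z.1.2 - z.2.2).

Variables (f g : R * R -> R).
Hypotheses (fi : leb2.-integrable setT (EFin \o f))
  (gi : leb2.-integrable setT (EFin \o g)).

Let mf : measurable_fun [set: plane] f.
Proof. by apply/measurable_EFinP; case/integrableP: fi. Qed.
Let mg : measurable_fun [set: plane] g.
Proof. by apply/measurable_EFinP; case/integrableP: gi. Qed.

Let gi_translate y :
  leb2.-integrable setT (EFin \o (fun x => g (x.1 - y.1, x.2 - y.2))).
Proof. exact: (integrable_measure_preserving (plane_translation y) gi). Qed.

Let measurable_sub : measurable_fun [set: plane * plane]
  (fun z => (z.1.1 - z.2.1, z.1.2 - z.2.2) : plane).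
Proof.
have m11 : measurable_fun [set: plane * plane] (fun z => z.1.1 : R).
  exact: (measurableT_comp measurable_fst measurable_fst).
have m12 : measurable_fun [set: plane * plane] (fun z => z.1.2 : R).
  exact: (measurableT_comp measurable_snd measurable_fst).
have m21 : measurable_fun [set: plane * plane] (fun z => z.2.1 : R).
  exact: (measurableT_comp measurable_fst measurable_snd).
have m22 : measurable_fun [set: plane * plane] (fun z => z.2.2 : R).
  exact: (measurableT_comp measurable_snd measurable_snd).
by apply: measurable_fun_pair; exact: measurable_funB.
Qed.

Let measurable_kernel : measurable_fun setT (kernel f g).
Proof.
apply: measurable_funM.
  exact: (measurableT_comp mf measurable_snd).
exact: (measurableT_comp mg measurable_sub).
Qed.

(** Tonelli, integrating in x first: translation invariance makes the inner integral |f y| times the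
    L^1 norm of g, so the total is the product of the two norms. *)
Lemma integrable_kernel : leb4.-integrable setT (EFin \o kernel f g).
Proof.
have /measurable_EFinP mK := measurable_kernel.
apply: (integrable21ltyP (plane_measure R) (plane_measure R) mK).2.
have [_ foo] := integrableP _ _ _ fi.
have [_ goo] := integrableP _ _ _ gi.
have gE y : (\int[leb2]_x `|(EFin \o kernel f g) (x, y)| =
    `|(f y)%:E| * \int[leb2]_x `|(g x)%:E|)%E.
  rewrite -(ge0_integral_measure_preserving (plane_translation y)
    (f := fun x => `|(g x)%:E|%E)); last 2 first.
  - by apply: measurableT_comp => //; exact/measurable_EFinP.
  - by move=> x; exact: abse_ge0.
  rewrite -ge0_integralZl//.
  - by apply: eq_integral => x _; rewrite /kernel /= normrM EFinM.
  - by apply: measurableT_comp => //; case/integrableP: (gi_translate y).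
under eq_integral do rewrite gE.
rewrite ge0_integralZr//.
- have f0 : (0 <= \int[leb2]_y `|(f y)%:E|)%E by exact: integral_ge0.
  by apply: lte_mul_pinfty => //; rewrite ge0_fin_numE.
- by apply: measurableT_comp => //; exact/measurable_EFinP.
- exact: integral_ge0.
Qed.

(** The function [G] evaluated at x - y is the integrand on the left, by the addition formula;
    translation invariance removes the shift. *)
Lemma translate_cos_transform y xi :
  \int[leb2]_x (g (x.1 - y.1, x.2 - y.2) * cos (dot x xi)) =
  cos (dot y xi) * cos_transform g xi - sin (dot y xi) * sin_transform g xi.
Proof.
have ci := integrable_mul_bounded gi (bounded_measurable_cos_dot xi).
have si := integrable_mul_bounded gi (bounded_measurable_sin_dot xi).
pose G x := cos (dot y xi) * (g x * cos (dot x xi)) -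
  sin (dot y xi) * (g x * sin (dot x xi)).
have Gi : leb2.-integrable setT (EFin \o G).
  exact: (integrableB measurableT (integrableZl measurableT (cos (dot y xi)) ci)
    (integrableZl measurableT (sin (dot y xi)) si)).
transitivity (\int[leb2]_x G x); last first.
  rewrite RintegralB ?RintegralZl//.
  - exact: (integrableZl measurableT (cos (dot y xi)) ci).
  - exact: (integrableZl measurableT (sin (dot y xi)) si).
rewrite -(Rintegral_measure_preserving (plane_translation y) Gi).
apply: eq_Rintegral => x _; rewrite /G.
rewrite (_ : dot x xi = dot (x.1 - y.1, x.2 - y.2) xi + dot y xi) ?cosD//.
  by ring.
by rewrite /dot /=; ring.
Qed.

Lemma translate_sin_transform y xi :
  \int[leb2]_x (g (x.1 - y.1, x.2 - y.2) * sin (dot x xi)) =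
  cos (dot y xi) * sin_transform g xi + sin (dot y xi) * cos_transform g xi.
Proof.
have ci := integrable_mul_bounded gi (bounded_measurable_cos_dot xi).
have si := integrable_mul_bounded gi (bounded_measurable_sin_dot xi).
pose G x := cos (dot y xi) * (g x * sin (dot x xi)) +
  sin (dot y xi) * (g x * cos (dot x xi)).
have Gi : leb2.-integrable setT (EFin \o G).
  exact: (integrableD measurableT (integrableZl measurableT (cos (dot y xi)) si)
    (integrableZl measurableT (sin (dot y xi)) ci)).
transitivity (\int[leb2]_x G x); last first.
  rewrite RintegralD ?RintegralZl//.
  - exact: (integrableZl measurableT (cos (dot y xi)) si).
  - exact: (integrableZl measurableT (sin (dot y xi)) ci).
rewrite -(Rintegral_measure_preserving (plane_translation y) Gi).
apply: eq_Rintegral => x _; rewrite /G.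
rewrite (_ : dot x xi = dot (x.1 - y.1, x.2 - y.2) xi + dot y xi) ?sinD//.
  by ring.
by rewrite /dot /=; ring.
Qed.

(** Fubini in the order opposite to that of the convolution: for fixed y, a translate of g is
    integrated against phi. *)
Lemma Rintegral_kernelM phi : bounded_measurable (T := plane) phi ->
  \int[leb4]_z (kernel f g z * phi z.1) =
  \int[leb2]_y (f y * \int[leb2]_x (g (x.1 - y.1, x.2 - y.2) * phi x)).
Proof.
move=> bphi; have [mphi [B phiB]] := bphi.
have Ki : leb4.-integrable setT (EFin \o (fun z => kernel f g z * phi z.1)).
  apply: integrable_mul_bounded => //; first exact: integrable_kernel.
  by split; [exact: (measurableT_comp mphi measurable_fst)|exists B].
rewrite /Rintegral -(integral21_prod_meas1 Ki); congr fine.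
apply: eq_integral => y _; rewrite /fubini_G /= /kernel /=.
have gphi := integrable_mul_bounded (gi_translate y) bphi.
rewrite EFinM fineK; last exact: integrable_fin_num.
rewrite -integralZl//.
by apply: eq_integral => x _; rewrite /= -EFinM mulrA.
Qed.

Lemma kernel_cos xi : \int[leb4]_z (kernel f g z * cos (dot z.1 xi)) =
  cos_transform f xi * cos_transform g xi -
  sin_transform f xi * sin_transform g xi.
Proof.
have ci := integrable_mul_bounded fi (bounded_measurable_cos_dot xi).
have si := integrable_mul_bounded fi (bounded_measurable_sin_dot xi).
rewrite (Rintegral_kernelM (bounded_measurable_cos_dot xi)).
under eq_Rintegral do rewrite translate_cos_transform mulrBr !mulrA.
rewrite RintegralB ?RintegralZr//.
- by apply: eq_integrable (integrableZr measurableT (cos_transform g xi) ci) => // x _.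
- by apply: eq_integrable (integrableZr measurableT (sin_transform g xi) si) => // x _.
Qed.

Lemma kernel_sin xi : \int[leb4]_z (kernel f g z * sin (dot z.1 xi)) =
  sin_transform f xi * cos_transform g xi +
  cos_transform f xi * sin_transform g xi.
Proof.
have ci := integrable_mul_bounded fi (bounded_measurable_cos_dot xi).
have si := integrable_mul_bounded fi (bounded_measurable_sin_dot xi).
rewrite (Rintegral_kernelM (bounded_measurable_sin_dot xi)).
under eq_Rintegral do rewrite translate_sin_transform mulrDr !mulrA.
rewrite RintegralD ?RintegralZr//; first by rewrite addrC.
- by apply: eq_integrable (integrableZr measurableT (sin_transform g xi) ci) => // x _.
- by apply: eq_integrable (integrableZr measurableT (cos_transform g xi) si) => // x _.
Qed.

End Kernel.

(** * Component calculus for quaternions and four-term combinations *)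

Section QuaternionComponents.
Variable R : comNzRingType.
Implicit Types p q : quaternion R.

Lemma quaternion_ext p q :
  q0 p = q0 q -> q1 p = q1 q -> q2 p = q2 q -> q3 p = q3 q -> p = q.
Proof. by case: p q => ? ? ? ? [? ? ? ?] /= -> -> -> ->. Qed.

(** These hold by conversion; they expose components so that [ring] and [field] apply over R. *)
Lemma addq_def p q : p + q = Defs.addq p q. Proof. by []. Qed.
Lemma oppq_def q : - q = Defs.oppq q. Proof. by []. Qed.
Lemma mulq_def p q : p * q = Defs.mulq p q. Proof. by []. Qed.
Lemma scaleq_def (a : R) q : a *: q = Defs.scaleq a q. Proof. by []. Qed.
Definition quaternionE := (addq_def, oppq_def, mulq_def, scaleq_def).

End QuaternionComponents.

Section LinearCombination.
Context d (T : measurableType d) (R : realType) (mu : {measure set T -> \bar R}).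
Variables (a b c e : T -> R) (s0 s1 s2 s3 : R).
Hypotheses (ai : mu.-integrable setT (EFin \o a))
  (bi : mu.-integrable setT (EFin \o b)) (ci : mu.-integrable setT (EFin \o c))
  (ei : mu.-integrable setT (EFin \o e)).

(** Four terms, since each component of a quaternion product is a signed sum of four real
    products. *)
Let comb4 x := s0 * a x + s1 * b x + s2 * c x + s3 * e x.
Let sai := integrableZl measurableT s0 ai.
Let sbi := integrableZl measurableT s1 bi.
Let sci := integrableZl measurableT s2 ci.
Let sei := integrableZl measurableT s3 ei.
Let sabi := integrableD measurableT sai sbi.
Let sabci := integrableD measurableT sabi sci.

Lemma integrable_comb4 : mu.-integrable setT (EFin \o comb4).
Proof. exact: (integrableD measurableT sabci sei). Qed.

Lemma Rintegral_comb4 : \int[mu]_x comb4 x = s0 * \int[mu]_x a x +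
  s1 * \int[mu]_x b x + s2 * \int[mu]_x c x + s3 * \int[mu]_x e x.
Proof.
rewrite /comb4 (RintegralD measurableT sabci sei).
by rewrite (RintegralD measurableT sabi sci) (RintegralD measurableT sai sbi)
  !RintegralZl.
Qed.

End LinearCombination.

(** * Integrals and trigonometric transforms of quaternion functions *)

Section QuaternionIntegral.
Variable R : realType.
Local Notation plane := (measurableTypeR R * measurableTypeR R)%type.
Local Notation leb2 := (lebesgue2 R).
Implicit Types (f g h : R * R -> quaternion R) (q mu : quaternion R).
Implicit Types x y : R * R.

Lemma qintegrableD f g : qintegrable f -> qintegrable g ->
  qintegrable (fun x => f x + g x).
Proof.
move=> [f0 f1 f2 f3] [g0 g1 g2 g3]; split.
- exact: (integrableD measurableT f0 g0).
- exact: (integrableD measurableT f1 g1).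
- exact: (integrableD measurableT f2 g2).
- exact: (integrableD measurableT f3 g3).
Qed.

Lemma qintegrableB f g : qintegrable f -> qintegrable g ->
  qintegrable (fun x => f x - g x).
Proof.
move=> [f0 f1 f2 f3] [g0 g1 g2 g3]; split.
- exact: (integrableB measurableT f0 g0).
- exact: (integrableB measurableT f1 g1).
- exact: (integrableB measurableT f2 g2).
- exact: (integrableB measurableT f3 g3).
Qed.

Lemma qintegrable_scale (phi : R * R -> R) f :
  bounded_measurable (T := plane) phi -> qintegrable f ->
  qintegrable (fun x => phi x *: f x).
Proof.
have h (k : R * R -> R) : bounded_measurable (T := plane) phi ->
    leb2.-integrable setT (EFin \o k) ->
    leb2.-integrable setT (EFin \o (fun x => phi x * k x)).
  move=> bphi ki; under [X in EFin \o X]eq_fun do rewrite mulrC.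
  exact: integrable_mul_bounded.
by move=> bphi [? ? ? ?]; split; exact: h.
Qed.

(** The coefficients passed to [H] are the rows of the real 4 by 4 matrix of left multiplication by
    q. *)
Lemma qintegrable_lmul q f : qintegrable f -> qintegrable (fun x => q * f x).
Proof.
move=> [i0 i1 i2 i3]; case: q => a b c e.
have H s0 s1 s2 s3 := integrable_comb4 s0 s1 s2 s3 i0 i1 i2 i3.
split.
- by apply: eq_integrable (H a (- b) (- c) (- e)) => // x _;
    congr EFin; rewrite /= ?quaternionE /=; ring.
- by apply: eq_integrable (H b a (- e) c) => // x _;
    congr EFin; rewrite /= ?quaternionE /=; ring.
- by apply: eq_integrable (H c e a (- b)) => // x _;
    congr EFin; rewrite /= ?quaternionE /=; ring.
- by apply: eq_integrable (H e (- c) b a) => // x _;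
    congr EFin; rewrite /= ?quaternionE /=; ring.
Qed.

Lemma qintegrable_rmul q f : qintegrable f -> qintegrable (fun x => f x * q).
Proof.
move=> [i0 i1 i2 i3]; case: q => a b c e.
have H s0 s1 s2 s3 := integrable_comb4 s0 s1 s2 s3 i0 i1 i2 i3.
split.
- by apply: eq_integrable (H a (- b) (- c) (- e)) => // x _;
    congr EFin; rewrite /= ?quaternionE /=; ring.
- by apply: eq_integrable (H b a e (- c)) => // x _;
    congr EFin; rewrite /= ?quaternionE /=; ring.
- by apply: eq_integrable (H c (- e) a b) => // x _;
    congr EFin; rewrite /= ?quaternionE /=; ring.
- by apply: eq_integrable (H e c (- b) a) => // x _;
    congr EFin; rewrite /= ?quaternionE /=; ring.
Qed.

Lemma qintegralD f g : qintegrable f -> qintegrable g ->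
  qintegral (fun x => f x + g x) = qintegral f + qintegral g.
Proof.
by move=> [? ? ? ?] [? ? ? ?]; apply: quaternion_ext;
  rewrite /qintegral /= RintegralD.
Qed.

Lemma qintegralB f g : qintegrable f -> qintegrable g ->
  qintegral (fun x => f x - g x) = qintegral f - qintegral g.
Proof.
by move=> [? ? ? ?] [? ? ? ?]; apply: quaternion_ext;
  rewrite /qintegral /= RintegralB.
Qed.

Lemma eq_qintegral f g : f =1 g -> qintegral f = qintegral g.
Proof. by move=> /funext ->. Qed.

Lemma qintegral_lmul q f : qintegrable f ->
  qintegral (fun x => q * f x) = q * qintegral f.
Proof.
move=> [i0 i1 i2 i3]; case: q => a b c e.
have H s0 s1 s2 s3 := Rintegral_comb4 s0 s1 s2 s3 i0 i1 i2 i3.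
apply: quaternion_ext; rewrite [in RHS]quaternionE /qintegral /=.
- transitivity (a * \int[leb2]_x q0 (f x) + - b * \int[leb2]_x q1 (f x) +
    - c * \int[leb2]_x q2 (f x) + - e * \int[leb2]_x q3 (f x)); last by ring.
  rewrite -H; apply: eq_Rintegral => x _; rewrite /= ?quaternionE /=; ring.
- transitivity (b * \int[leb2]_x q0 (f x) + a * \int[leb2]_x q1 (f x) +
    - e * \int[leb2]_x q2 (f x) + c * \int[leb2]_x q3 (f x)); last by ring.
  rewrite -H; apply: eq_Rintegral => x _; rewrite /= ?quaternionE /=; ring.
- transitivity (c * \int[leb2]_x q0 (f x) + e * \int[leb2]_x q1 (f x) +
    a * \int[leb2]_x q2 (f x) + - b * \int[leb2]_x q3 (f x)); last by ring.
  rewrite -H; apply: eq_Rintegral => x _; rewrite /= ?quaternionE /=; ring.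
- transitivity (e * \int[leb2]_x q0 (f x) + - c * \int[leb2]_x q1 (f x) +
    b * \int[leb2]_x q2 (f x) + a * \int[leb2]_x q3 (f x)); last by ring.
  rewrite -H; apply: eq_Rintegral => x _; rewrite /= ?quaternionE /=; ring.
Qed.

Lemma qintegral_rmul q f : qintegrable f ->
  qintegral (fun x => f x * q) = qintegral f * q.
Proof.
move=> [i0 i1 i2 i3]; case: q => a b c e.
have H s0 s1 s2 s3 := Rintegral_comb4 s0 s1 s2 s3 i0 i1 i2 i3.
apply: quaternion_ext; rewrite [in RHS]quaternionE /qintegral /=.
- transitivity (a * \int[leb2]_x q0 (f x) + - b * \int[leb2]_x q1 (f x) +
    - c * \int[leb2]_x q2 (f x) + - e * \int[leb2]_x q3 (f x)); last by ring.
  rewrite -H; apply: eq_Rintegral => x _; rewrite /= ?quaternionE /=; ring.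
- transitivity (b * \int[leb2]_x q0 (f x) + a * \int[leb2]_x q1 (f x) +
    e * \int[leb2]_x q2 (f x) + - c * \int[leb2]_x q3 (f x)); last by ring.
  rewrite -H; apply: eq_Rintegral => x _; rewrite /= ?quaternionE /=; ring.
- transitivity (c * \int[leb2]_x q0 (f x) + - e * \int[leb2]_x q1 (f x) +
    a * \int[leb2]_x q2 (f x) + b * \int[leb2]_x q3 (f x)); last by ring.
  rewrite -H; apply: eq_Rintegral => x _; rewrite /= ?quaternionE /=; ring.
- transitivity (e * \int[leb2]_x q0 (f x) + c * \int[leb2]_x q1 (f x) +
    - b * \int[leb2]_x q2 (f x) + a * \int[leb2]_x q3 (f x)); last by ring.
  rewrite -H; apply: eq_Rintegral => x _; rewrite /= ?quaternionE /=; ring.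
Qed.

(** Being weighted by real functions, these transforms let quaternion constants out on both sides,
    which [qfourier mu] does not do on the left in general. *)
Definition qcos_transform f xi := qintegral (fun x => cos (dot x xi) *: f x).
Definition qsin_transform f xi := qintegral (fun x => sin (dot x xi) *: f x).

Lemma qcos_transformE f xi : qcos_transform f xi = Quaternion
  (cos_transform (fun x => q0 (f x)) xi) (cos_transform (fun x => q1 (f x)) xi)
  (cos_transform (fun x => q2 (f x)) xi) (cos_transform (fun x => q3 (f x)) xi).
Proof.
by apply: quaternion_ext; apply: eq_Rintegral => x _; rewrite /= ?quaternionE /= mulrC.
Qed.

Lemma qsin_transformE f xi : qsin_transform f xi = Quaternion
  (sin_transform (fun x => q0 (f x)) xi) (sin_transform (fun x => q1 (f x)) xi)
  (sin_transform (fun x => q2 (f x)) xi) (sin_transform (fun x => q3 (f x)) xi).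
Proof.
by apply: quaternion_ext; apply: eq_Rintegral => x _; rewrite /= ?quaternionE /= mulrC.
Qed.

Lemma qintegrable_cos f xi : qintegrable f ->
  qintegrable (fun x => cos (dot x xi) *: f x).
Proof. exact/qintegrable_scale/bounded_measurable_cos_dot. Qed.

Lemma qintegrable_sin f xi : qintegrable f ->
  qintegrable (fun x => sin (dot x xi) *: f x).
Proof. exact/qintegrable_scale/bounded_measurable_sin_dot. Qed.

Lemma qfourierE mu f xi : qintegrable f ->
  qfourier mu f xi =
    (2 * pi)^-1 *: (qcos_transform f xi - mu * qsin_transform f xi).
Proof.
move=> fi; congr (_ *: _).
have ci := qintegrable_cos xi fi; have si := qintegrable_sin xi fi.
rewrite -qintegral_lmul// -qintegralB//; last exact: qintegrable_lmul.
apply: eq_qintegral => x; rewrite /qexp -/(dot x xi) cosN sinN.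
by rewrite mulrDl scaleNr mulNr -!scalerAl mul1r scalerAr.
Qed.

End QuaternionIntegral.

(** * One component of a quaternion convolution *)

Section KernelCombination.
Variable R : realType.
Local Notation plane := (measurableTypeR R * measurableTypeR R)%type.
Local Notation leb2 := (lebesgue2 R).
Local Notation leb4 := (plane_measure R \x plane_measure R)%E.
Variables (f0 f1 f2 f3 g0 g1 g2 g3 : R * R -> R) (s0 s1 s2 s3 : R).
Hypotheses (f0i : leb2.-integrable setT (EFin \o f0))
  (f1i : leb2.-integrable setT (EFin \o f1))
  (f2i : leb2.-integrable setT (EFin \o f2))
  (f3i : leb2.-integrable setT (EFin \o f3))
  (g0i : leb2.-integrable setT (EFin \o g0))
  (g1i : leb2.-integrable setT (EFin \o g1))
  (g2i : leb2.-integrable setT (EFin \o g2))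
  (g3i : leb2.-integrable setT (EFin \o g3)).

Definition kernel4 z := s0 * kernel f0 g0 z + s1 * kernel f1 g1 z +
  s2 * kernel f2 g2 z + s3 * kernel f3 g3 z.

(** The four kernels are added before integrating: at a given x their separate sections may fail to
    be integrable, so the sum is split only in integrals over both variables. *)
Definition conv4 x := \int[leb2]_y kernel4 (x, y).

Let k0i := integrable_kernel f0i g0i.
Let k1i := integrable_kernel f1i g1i.
Let k2i := integrable_kernel f2i g2i.
Let k3i := integrable_kernel f3i g3i.
Let kernel4i : leb4.-integrable setT (EFin \o kernel4) :=
  integrable_comb4 s0 s1 s2 s3 k0i k1i k2i k3i.

Lemma integrable_conv4 : leb2.-integrable setT (EFin \o conv4).
Proof. exact: (integrable_marginal kernel4i). Qed.

Let conv4M phi : bounded_measurable (T := plane) phi ->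
  \int[leb2]_x (conv4 x * phi x) =
  s0 * (\int[leb4]_z (kernel f0 g0 z * phi z.1)) +
  s1 * (\int[leb4]_z (kernel f1 g1 z * phi z.1)) +
  s2 * (\int[leb4]_z (kernel f2 g2 z * phi z.1)) +
  s3 * (\int[leb4]_z (kernel f3 g3 z * phi z.1)).
Proof.
move=> bphi; rewrite [LHS](Rintegral_marginalM kernel4i bphi).
have bphi1 : bounded_measurable (T := (plane * plane)%type) (fun z => phi z.1).
  have [mphi [B phiB]] := bphi.
  by split; [exact: (measurableT_comp mphi measurable_fst)|exists B].
rewrite -(Rintegral_comb4 s0 s1 s2 s3
  (integrable_mul_bounded k0i bphi1) (integrable_mul_bounded k1i bphi1)
  (integrable_mul_bounded k2i bphi1) (integrable_mul_bounded k3i bphi1)).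
by apply: eq_Rintegral => z _; rewrite /kernel4; ring.
Qed.

Lemma cos_transform_conv4 xi : cos_transform conv4 xi =
  s0 * (cos_transform f0 xi * cos_transform g0 xi -
        sin_transform f0 xi * sin_transform g0 xi) +
  s1 * (cos_transform f1 xi * cos_transform g1 xi -
        sin_transform f1 xi * sin_transform g1 xi) +
  s2 * (cos_transform f2 xi * cos_transform g2 xi -
        sin_transform f2 xi * sin_transform g2 xi) +
  s3 * (cos_transform f3 xi * cos_transform g3 xi -
        sin_transform f3 xi * sin_transform g3 xi).
Proof.
by rewrite /cos_transform (conv4M (bounded_measurable_cos_dot xi)) !kernel_cos.
Qed.

Lemma sin_transform_conv4 xi : sin_transform conv4 xi =
  s0 * (sin_transform f0 xi * cos_transform g0 xi +
        cos_transform f0 xi * sin_transform g0 xi) +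
  s1 * (sin_transform f1 xi * cos_transform g1 xi +
        cos_transform f1 xi * sin_transform g1 xi) +
  s2 * (sin_transform f2 xi * cos_transform g2 xi +
        cos_transform f2 xi * sin_transform g2 xi) +
  s3 * (sin_transform f3 xi * cos_transform g3 xi +
        cos_transform f3 xi * sin_transform g3 xi).
Proof.
by rewrite /sin_transform (conv4M (bounded_measurable_sin_dot xi)) !kernel_sin.
Qed.

End KernelCombination.

(** * Quaternion convolution and reflection under the two transforms *)

Section Convolution.
Variable R : realType.
Local Notation plane := (measurableTypeR R * measurableTypeR R)%type.
Local Notation leb2 := (lebesgue2 R).
Implicit Types (f g h : R * R -> quaternion R) (q mu : quaternion R).
Implicit Types x y xi : R * R.

(* The signs are those of Hamilton's product. *)
Lemma qconv_conv4 f g : qconv f g = fun x =>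
  let F0 y := q0 (f y) in let F1 y := q1 (f y) in
  let F2 y := q2 (f y) in let F3 y := q3 (f y) in
  let G0 y := q0 (g y) in let G1 y := q1 (g y) in
  let G2 y := q2 (g y) in let G3 y := q3 (g y) in
  Quaternion (conv4 F0 F1 F2 F3 G0 G1 G2 G3 1 (-1) (-1) (-1) x)
    (conv4 F0 F1 F2 F3 G1 G0 G3 G2 1 1 1 (-1) x)
    (conv4 F0 F1 F2 F3 G2 G3 G0 G1 1 (-1) 1 1 x)
    (conv4 F0 F1 F2 F3 G3 G2 G1 G0 1 1 (-1) 1 x).
Proof.
apply/funext => x; rewrite /qconv /qintegral /=.
by congr Quaternion; apply: eq_Rintegral => y _;
  rewrite /kernel4 /kernel /=; ring.
Qed.

Lemma qintegrable_qconv f g : qintegrable f -> qintegrable g ->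
  qintegrable (qconv f g).
Proof.
move=> [? ? ? ?] [? ? ? ?]; rewrite qconv_conv4.
by split; exact: integrable_conv4.
Qed.

Lemma qcos_transform_qconv f g xi : qintegrable f -> qintegrable g ->
  qcos_transform (qconv f g) xi =
    qcos_transform f xi * qcos_transform g xi -
    qsin_transform f xi * qsin_transform g xi.
Proof.
move=> [? ? ? ?] [? ? ? ?]; rewrite qconv_conv4 !qcos_transformE !qsin_transformE.
by apply: quaternion_ext; rewrite /= cos_transform_conv4//; ring.
Qed.

Lemma qsin_transform_qconv f g xi : qintegrable f -> qintegrable g ->
  qsin_transform (qconv f g) xi =
    qsin_transform f xi * qcos_transform g xi +
    qcos_transform f xi * qsin_transform g xi.
Proof.
move=> [? ? ? ?] [? ? ? ?]; rewrite qconv_conv4 !qcos_transformE !qsin_transformE.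
by apply: quaternion_ext; rewrite /= sin_transform_conv4//; ring.
Qed.

Lemma reflection11E g : reflection (true, true) g = fun x => g (- x.1, - x.2).
Proof. by apply/funext => x; rewrite /reflection /= expr1 !mulN1r. Qed.

Lemma qintegrable_reflection11 g : qintegrable g ->
  qintegrable (reflection (true, true) g).
Proof.
rewrite reflection11E => -[i0 i1 i2 i3].
have H := integrable_measure_preserving (plane_opp R).
by split; [exact: (H _ i0)|exact: (H _ i1)|exact: (H _ i2)|exact: (H _ i3)].
Qed.

Let dotNl x xi : dot (- x.1, - x.2) xi = - dot x xi.
Proof. by rewrite /dot /=; ring. Qed.

(** Substituting - x keeps the transform against the even cosine; against the odd sine it changes
    the sign. Reflecting g thus flips one of the two products in each transform of a convolution. *)
Lemma qcos_transform_reflection11 g xi : qintegrable g ->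
  qcos_transform (reflection (true, true) g) xi = qcos_transform g xi.
Proof.
move=> [i0 i1 i2 i3]; rewrite reflection11E !qcos_transformE.
have H (k : R * R -> R) : leb2.-integrable setT (EFin \o k) ->
    cos_transform (fun x => k (- x.1, - x.2)) xi = cos_transform k xi.
  move=> ki; rewrite /cos_transform -(Rintegral_measure_preserving (plane_opp R)
    (integrable_mul_bounded ki (bounded_measurable_cos_dot xi))).
  by apply: eq_Rintegral => x _; rewrite dotNl cosN.
by rewrite (H _ i0) (H _ i1) (H _ i2) (H _ i3).
Qed.

Lemma qsin_transform_reflection11 g xi : qintegrable g ->
  qsin_transform (reflection (true, true) g) xi = - qsin_transform g xi.
Proof.
move=> [i0 i1 i2 i3]; rewrite reflection11E !qsin_transformE.
have H (k : R * R -> R) : leb2.-integrable setT (EFin \o k) ->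
    sin_transform (fun x => k (- x.1, - x.2)) xi = - sin_transform k xi.
  move=> ki; have bs := bounded_measurable_sin_dot xi.
  rewrite /sin_transform -(Rintegral_measure_preserving (plane_opp R)
    (integrable_mul_bounded ki bs)) -mulN1r -RintegralZl//; last first.
    exact: (integrable_measure_preserving (plane_opp R)
      (integrable_mul_bounded ki bs)).
  by apply: eq_Rintegral => x _; rewrite dotNl sinN; ring.
by rewrite (H _ i0) (H _ i1) (H _ i2) (H _ i3).
Qed.

End Convolution.

(** * Linearity of the transforms, with left and right quaternion factors *)

Section TransformLinearity.
Variable R : realType.
Implicit Types (f g : R * R -> quaternion R) (q : quaternion R) (xi : R * R).

Lemma qcos_transformD f g xi : qintegrable f -> qintegrable g ->
  qcos_transform (fun x => f x + g x) xi =
    qcos_transform f xi + qcos_transform g xi.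
Proof.
move=> fi gi; rewrite -qintegralD; [|exact: qintegrable_cos..].
by apply: eq_qintegral => x; rewrite scalerDr.
Qed.

Lemma qsin_transformD f g xi : qintegrable f -> qintegrable g ->
  qsin_transform (fun x => f x + g x) xi =
    qsin_transform f xi + qsin_transform g xi.
Proof.
move=> fi gi; rewrite -qintegralD; [|exact: qintegrable_sin..].
by apply: eq_qintegral => x; rewrite scalerDr.
Qed.

Lemma qcos_transform_lmul q f xi : qintegrable f ->
  qcos_transform (fun x => q * f x) xi = q * qcos_transform f xi.
Proof.
move=> fi; rewrite -qintegral_lmul; last exact: qintegrable_cos.
by apply: eq_qintegral => x; rewrite scalerAr.
Qed.

Lemma qsin_transform_lmul q f xi : qintegrable f ->
  qsin_transform (fun x => q * f x) xi = q * qsin_transform f xi.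
Proof.
move=> fi; rewrite -qintegral_lmul; last exact: qintegrable_sin.
by apply: eq_qintegral => x; rewrite scalerAr.
Qed.

Lemma qcos_transform_rmul q f xi : qintegrable f ->
  qcos_transform (fun x => f x * q) xi = qcos_transform f xi * q.
Proof.
move=> fi; rewrite -qintegral_rmul; last exact: qintegrable_cos.
by apply: eq_qintegral => x; rewrite scalerAl.
Qed.

Lemma qsin_transform_rmul q f xi : qintegrable f ->
  qsin_transform (fun x => f x * q) xi = qsin_transform f xi * q.
Proof.
move=> fi; rewrite -qintegral_rmul; last exact: qintegrable_sin.
by apply: eq_qintegral => x; rewrite scalerAl.
Qed.

Lemma qfourierD mu f g xi : qintegrable f -> qintegrable g ->
  qfourier mu (fun x => f x + g x) xi = qfourier mu f xi + qfourier mu g xi.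
Proof.
move=> fi gi; rewrite !qfourierE//; last exact: qintegrableD.
rewrite qcos_transformD// qsin_transformD// -scalerDr; congr (_ *: _).
by rewrite mulrDr opprD addrACA.
Qed.

Lemma qfourierZ mu (a : R) f xi : qintegrable f ->
  qfourier mu (fun x => a *: f x) xi = a *: qfourier mu f xi.
Proof.
have -> : (fun x => a *: f x) = fun x => a%:A * f x.
  by apply/funext => x; rewrite mulr_algl.
move=> fi; rewrite !qfourierE//; last exact: qintegrable_lmul.
rewrite qcos_transform_lmul// qsin_transform_lmul// !mulr_algl.
by rewrite -scalerAr -scalerBr !scalerA mulrC.
Qed.

Lemma qintegrableZ (a : R) f : qintegrable f -> qintegrable (fun x => a *: f x).
Proof.
move=> fi; have -> : (fun x => a *: f x) = fun x => a%:A * f x.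
  by apply/funext => x; rewrite mulr_algl.
exact: qintegrable_lmul.
Qed.

Lemma qfourierB mu f g xi : qintegrable f -> qintegrable g ->
  qfourier mu (fun x => f x - g x) xi = qfourier mu f xi - qfourier mu g xi.
Proof.
move=> fi gi.
have -> : (fun x => f x - g x) = fun x => f x + (-1) *: g x.
  by apply/funext => x; rewrite scaleN1r.
by rewrite qfourierD ?qfourierZ ?scaleN1r//; exact: qintegrableZ.
Qed.

End TransformLinearity.

(** * Injectivity of the quaternion transform and explicit Mustard convolutions *)

Section Uniqueness.
Variable R : realType.
Local Notation leb2 := (lebesgue2 R).
Variable mu : quaternion R.
Hypothesis mu2 : mu ^+ 2 = -1.
Implicit Types (f g h : R * R -> quaternion R) (x xi : R * R).

Let mumu q : mu * (mu * q) = - q.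
Proof. by rewrite mulrA -expr2 mu2 mulN1r. Qed.

Lemma qcos_transformN h xi :
  qcos_transform h (- xi.1, - xi.2) = qcos_transform h xi.
Proof. by apply: eq_qintegral => x; rewrite dotNr cosN. Qed.

Lemma qsin_transformN h xi : qintegrable h ->
  qsin_transform h (- xi.1, - xi.2) = - qsin_transform h xi.
Proof.
move=> hi; rewrite -[RHS]mulN1r -qintegral_lmul; last exact: qintegrable_sin.
by apply: eq_qintegral => x; rewrite dotNr sinN scaleNr mulN1r.
Qed.

(* Comparing the values at xi and - xi separates the even cosine part from the
   odd sine part. *)
Lemma qfourier_eq0 h : qintegrable h -> (forall xi, qfourier mu h xi = 0) ->
  {ae leb2, forall x, h x = 0}.
Proof.
move=> hi h0.
have CS xi : qcos_transform h xi = mu * qsin_transform h xi.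
  have /eqP := h0 xi; rewrite qfourierE// scaler_eq0 invr_eq0.
  rewrite mulf_eq0 pnatr_eq0 /= gt_eqF ?pi_gt0//= subr_eq0 => /eqP //.
have C0 xi : qcos_transform h xi = 0.
  have := CS (- xi.1, - xi.2); rewrite qcos_transformN qsin_transformN// mulrN -CS => E.
  have : (2 : R) *: qcos_transform h xi = 0 by rewrite scaler_nat mulr2n {1}E addNr.
  by move/eqP; rewrite scaler_eq0 pnatr_eq0 => /eqP.
(* With zero cosine part, mu S = 0 for the sine part S; a second multiplication by mu gives - S =
   0. *)
have S0 xi : qsin_transform h xi = 0.
  by have := mumu (qsin_transform h xi); rewrite -CS C0 mulr0 => /eqP;
    rewrite eq_sym oppr_eq0 => /eqP.
have [i0 i1 i2 i3] := hi.
have a0 : {ae leb2, forall x, q0 (h x) = 0}.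
  apply: (trig_transform_injective i0) => xi.
    by have := congr1 (@q0 R) (C0 xi); rewrite qcos_transformE.
  by have := congr1 (@q0 R) (S0 xi); rewrite qsin_transformE.
have a1 : {ae leb2, forall x, q1 (h x) = 0}.
  apply: (trig_transform_injective i1) => xi.
    by have := congr1 (@q1 R) (C0 xi); rewrite qcos_transformE.
  by have := congr1 (@q1 R) (S0 xi); rewrite qsin_transformE.
have a2 : {ae leb2, forall x, q2 (h x) = 0}.
  apply: (trig_transform_injective i2) => xi.
    by have := congr1 (@q2 R) (C0 xi); rewrite qcos_transformE.
  by have := congr1 (@q2 R) (S0 xi); rewrite qsin_transformE.
have a3 : {ae leb2, forall x, q3 (h x) = 0}.
  apply: (trig_transform_injective i3) => xi.
    by have := congr1 (@q3 R) (C0 xi); rewrite qcos_transformE.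
  by have := congr1 (@q3 R) (S0 xi); rewrite qsin_transformE.
have aeF := ae_filter_ringOfSetsType leb2.
have a01 : {ae leb2, forall x, q0 (h x) = 0 /\ q1 (h x) = 0}.
  by move: a0 a1; apply: filterS2 => x -> ->.
move: a01 a2 a3; apply: filterS3 => x [? ?] ? ?.
exact: quaternion_ext.
Qed.

Lemma mustard_ae_eq f g h : is_mustard mu f g h ->
  {ae leb2, forall x, mustard mu f g x = h x}.
Proof.
(* Existence is witnessed by h, so [xget] does not fall back to the zero function. *)
move=> hh; have [mi mE] : is_mustard mu f g (mustard mu f g).
  by apply: xgetPex; exists h.
have [hi hE] := hh.
have di := qintegrableB mi hi.
have /(qfourier_eq0 di) : forall xi,
    qfourier mu (fun x => mustard mu f g x - h x) xi = 0.
  by move=> xi; rewrite qfourierB// mE hE subrr.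
by apply: (@filterS _ _ (ae_filter_ringOfSetsType leb2)) => x /eqP;
  rewrite subr_eq0 => /eqP.
Qed.

(** Up to sign, conjugation by mu, whose inverse is - mu. *)
Definition conj_root f x := mu * f x * mu.

(* Splitting each exponential into its cosine and sine parts, F f F g becomes a
   combination of products which these four convolutions reproduce. *)
Definition mustard_conv f g x := 2^-1 *: (qconv f g x - qconv (conj_root f) g x +
  qconv f (reflection (true, true) g) x +
  qconv (conj_root f) (reflection (true, true) g) x).

(** Write A, B and C, D for the cosine and sine transforms of f and g. The combination has cosine
    transform A C + mu B mu D and sine transform B C - mu A mu D, so its Fourier transform is, up to
    normalization, (A - mu B) (C - mu D). *)
Lemma is_mustard_mustard_conv f g : qintegrable f -> qintegrable g ->
  is_mustard mu f g (mustard_conv f g).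
Proof.
move=> fi gi; set g' := reflection (true, true) g.
have g'i : qintegrable g' by exact: qintegrable_reflection11.
have fmi : qintegrable (fun x => mu * f x) by exact: qintegrable_lmul.
have f'i : qintegrable (conj_root f) by exact: qintegrable_rmul.
have ai := qintegrable_qconv fi gi; have bi := qintegrable_qconv f'i gi.
have ci := qintegrable_qconv fi g'i; have di := qintegrable_qconv f'i g'i.
have abi := qintegrableB ai bi; have abci := qintegrableD abi ci.
have abcdi := qintegrableD abci di.
split; first exact: qintegrableZ.
move=> xi; rewrite qfourierZ// (qfourierD _ _ abci di) (qfourierD _ _ abi ci).
rewrite (qfourierB _ _ ai bi) !qfourierE//.
rewrite !qcos_transform_qconv// !qsin_transform_qconv//.
rewrite qcos_transform_reflection11// qsin_transform_reflection11//.
rewrite /conj_root qcos_transform_rmul// qsin_transform_rmul//.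
rewrite qcos_transform_lmul// qsin_transform_lmul//.
set A := qcos_transform f xi; set B := qsin_transform f xi.
set C := qcos_transform g xi; set D := qsin_transform g xi.
set c := (2 * pi)^-1.
(* One of the two factors (2 pi)^-1 on the right is absorbed by the factor 2 pi. *)
have cE : 2 * pi * c * c = c.
  by rewrite /c mulfV ?mul1r// mulf_neq0 ?pnatr_eq0// gt_eqF ?pi_gt0.
rewrite -scalerBr -!scalerDr [2^-1 *: _]scalerA [2^-1 * _]mulrC.
rewrite -[in RHS]scalerAl -[in RHS]scalerAr !scalerA cE -scalerA.
congr (_ *: _).
have mm : mu * mu = -1 by rewrite -expr2.
rewrite !(mulrDl, mulrDr, mulrN, mulNr, opprD, opprK, mulrA) !mm.
rewrite !(mulN1r, mulNr, opprK).
(* The eight remaining noncommutative products enter linearly, so they can be treated as independent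
   quaternions. *)
move: (A * C) (B * D) (mu * B * C) (mu * A * D) (mu * A * mu * C)
  (mu * B * mu * D) (B * mu * C) (A * mu * D) => X1 X2 X3 X4 X5 X6 X7 X8.
by apply: quaternion_ext; rewrite /= ?quaternionE /=; field.
Qed.

(* The integrands satisfy (mu f) (mu g) = (mu f mu) g and (mu (mu f) mu) (mu g) = f g,
   so that all sixteen convolutions are among the four of mustard_conv f g. *)
Lemma qconv_mustard_conv f g x :
  let g' := reflection (true, true) g in
  qconv f g x = 2^-1 *: (mustard_conv f g x
    - mustard_conv (lmulqf mu f) (lmulqf mu g) x
    + mustard_conv f g' x + mustard_conv (lmulqf mu f) (lmulqf mu g') x).
Proof.
move=> g'.
have g'K : reflection (true, true) g' = g.
  by rewrite /g' !reflection11E; apply/funext => -[x1 x2]; rewrite /= !opprK.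
have lmulR k : reflection (true, true) (lmulqf mu k) =
    lmulqf mu (reflection (true, true) k) by [].
have mulmul k : qconv (lmulqf mu f) (lmulqf mu k) x = qconv (conj_root f) k x.
  by apply: eq_qintegral => y; rewrite /lmulqf /conj_root mulrA.
have conjmul k : qconv (conj_root (lmulqf mu f)) (lmulqf mu k) x = qconv f k x.
  apply: eq_qintegral => y; rewrite /lmulqf /conj_root mumu.
  by rewrite -mulrA mumu mulrNN.
rewrite /mustard_conv !lmulR g'K !mulmul !conjmul -/g'.
(* With the signs +, -, +, + the first convolution adds up to 2 X1, while X2, X3 and X4 cancel. *)
move: (qconv f g x) (qconv (conj_root f) g x) (qconv f g' x)
  (qconv (conj_root f) g' x) => X1 X2 X3 X4.
by apply: quaternion_ext; rewrite /= ?quaternionE /=; field.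
Qed.

End Uniqueness.

Unset Implicit Arguments.

Theorem theorem3p1 (R : realType) (mu : quaternion R) (hmu : mu ^+ 2 = -1)
    (f g : R * R -> quaternion R) (hf : qintegrable f) (hg : qintegrable g) :
  {ae lebesgue2 R, forall x,
    qconv f g x =
      2^-1 *: (mustard mu f g x
               - mustard mu (lmulqf mu f) (lmulqf mu g) x
               + mustard mu f (reflection (true, true) g) x
               + mustard mu (lmulqf mu f)
                   (lmulqf mu (reflection (true, true) g)) x)}.
Proof.
have fmi : qintegrable (lmulqf mu f) by exact: qintegrable_lmul.
have gi' := qintegrable_reflection11 hg.
have gmi : qintegrable (lmulqf mu g) by exact: qintegrable_lmul.
have gmi' : qintegrable (lmulqf mu (reflection (true, true) g)).
  exact: qintegrable_lmul.
have mustardE h k hi ki := mustard_ae_eq hmu (is_mustard_mustard_conv hmu hi ki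
  : is_mustard mu h k (mustard_conv mu h k)).
have aeF := ae_filter_ringOfSetsType (lebesgue2 R).
(* Off the union of four null sets the chosen functions equal their explicit representatives, for
   which the identity is pointwise. *)
apply: (filterS3 _ _ (filterI (mustardE _ _ hf hg) (mustardE _ _ fmi gmi))
  (mustardE _ _ hf gi') (mustardE _ _ fmi gmi')) => x [-> ->] -> ->.
exact: qconv_mustard_conv.
Qed.
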